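(* Let $Q$ be a real symmetric negative semidefinite $n\times n$ matrix, $c\in\mathbf{R}^n$, and let $X=\{x\in\mathbf{R}^n:Ax\le b\}$ be a polytope with nonempty interior. Let $\epsilon>0$. Apply the branch and cut algorithm described in the context, with stopping accuracy $\epsilon$, to the concave quadratic program $\min\{x^TQx+2c^Tx:x\in X\}$, with the branching directions chosen so that, along every infinite sequence of successively generated nested nodes, the diameters of the corresponding polytopes tend to zero. Then the algorithm is finitely convergent: after finitely many steps every node has been fathomed and the algorithm stops.
   Context: Write $q(x)=x^TQx+2c^Tx$ and $B(x,y)=x^TQy+c^Tx+c^Ty$, so that $B(x,x)=q(x)$. A vertex of a polytope is called local optimal (for $q$) if the value of $q$ at it is at most the value of $q$ at every adjacent vertex. The algorithm. It keeps a best upper bound $u$ (initially $+\infty$; always the minimum of the values of $q$ at all the vertices computed so far), and a list of active nodes, each of which is a nonempty polytope contained in $X$. Initially the only node is $X$. All active nodes of the current generation are processed as follows; the nodes created in the process form the next generation. The algorithm stops when the next generation is empty. To process a node $\bar X=\{x:\bar Ax\le\bar b\}$: 1. Bounding. Solve the semidefinite program $$\max\ \ell\quad\text{s.t.}\quad \begin{pmatrix}-\bar A^TY\bar A & \bar A^T(Y\bar b+\tfrac12 y)\\ (Y\bar b+\tfrac12y)^T\bar A & -y^T\bar b-\bar b^TY\bar b\end{pmatrix}+\begin{pmatrix}Q&c\\c^T&-\ell\end{pmatrix}\succeq0,\quad \ell\le u,\quad Y\ge0,\ Y=Y^T,\ y\ge0,$$ with $Y,y$ a matrix and a vector of appropriate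 size (inequalities entrywise). Let $\bar\ell$ be its optimal value (the lower bound of the node) and $\bar Y,\bar y$ an optimal solution. 2. Upper bound. Let $\hat x$ be a solution of the convex quadratic program of minimizing $x^T(Q-\bar A^T\bar Y\bar A)x+2(c+\bar A^T\bar Y\bar b+\tfrac12\bar A^T\bar y)^Tx$ over $X$. Compute a local optimal vertex $\bar x$ of $X$ with $q(\bar x)\le q(\hat x)$ and replace $u$ by $\min(u,q(\bar x))$. 3. Fathoming. If $\bar\ell+\epsilon\ge u$, the node is fathomed (discarded). Otherwise, solve the convex quadratic program of step 2 over $\bar X$ in place of $X$, and compute a local optimal vertex $\bar x$ of $\bar X$ whose value $q(\bar x)$ is at most the value of $q$ at the solution found. Replace $u$ by $\min(u,q(\bar x))$. 4. Cutting (performed if the vertex $\bar x$ of $\bar X$ is non-degenerate). Let $g_1,\dots,g_n$ be the extreme directions of $\bar X$ at $\bar x$, and write $x=\bar x+\sum_i\xi_ig_i$. Put $t_i=\max\{\theta: q(\bar x+\theta g_i)\ge u-\epsilon\}$ and let $T$ be the set of points of $\bar X$ with $\sum_i\xi_i/t_i\ge1$ (Tuy's cut). For each $i$ let $y^i$ minimize $B(\bar x+t_ig_i,y)$ over $y\in T$. The vertex $\bar x$ is eligible if $\min_iq(y^i)\ge u-\epsilon$. If it is eligible, put $s_i=\max\{\theta: B(\bar x+\theta g_i,y)\ge u-\epsilon\ \text{for all }y\in T\}$ and replace $\bar X$ by its subset defined by Konno's cut $\sum_i\xi_i/s_i\ge1$. (Conventions: $1/\infty=0$, and a minimum over the empty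 set is $+\infty$.) If the new set is empty, the node is fathomed. 5. Branching. If $\bar X$ is nonempty, choose a nonzero vector $d\in\mathbf{R}^n$ and a Chebyshev center $x_c$ of $\bar X$, and create the two new nodes $\{x\in\bar X:d^Tx\le d^Tx_c\}$ and $\{x\in\bar X:d^Tx\ge d^Tx_c\}$. *)

(* Defs.v *)
From HB Require Import structures.
From mathcomp Require Import all_boot all_order all_algebra.
From mathcomp Require Import all_classical all_reals all_analysis.

Set Implicit Arguments.
Unset Strict Implicit.
Unset Printing Implicit Defensive.

Import Order.TTheory GRing.Theory Num.Theory.
Import numFieldNormedType.Exports.

Local Open Scope classical_set_scope.
Local Open Scope ring_scope.

Section Geometry.
Context {R : realType} {n : nat}.
Implicit Types (P F : set 'cV[R]_n) (v w x y : 'cV[R]_n).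

Definition dot x y : R := (x^T *m y) 0 0.

(* The library's norm on matrices is the max norm; balls and diameters below
   are Euclidean. *)
Definition enorm x : R := Num.sqrt (dot x x).

Definition diameter P : R :=
  sup [set r | exists x y, [/\ P x, P y & r = enorm (x - y)]].

Definition segment v w : set 'cV[R]_n :=
  [set x | exists2 l : R, 0 <= l <= 1 & x = (1 - l) *: v + l *: w].

(* [F] is a face of [P]: cut out of [P] by a valid inequality. *)
Definition is_face P F : Prop :=
  exists (a : 'cV[R]_n) (beta : R),
    (forall x, P x -> dot a x <= beta) /\
    F = P `&` [set x | dot a x = beta].

Definition is_vertex P v : Prop := is_face P [set v].

Definition adjacent P v w : Prop :=
  [/\ is_vertex P v, is_vertex P w, v <> w & is_face P (segment v w)].

Definition local_opt_vertex (f : 'cV[R]_n -> R) P v : Prop :=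
  is_vertex P v /\ forall w, adjacent P v w -> f v <= f w.

Definition minimizer (f : 'cV[R]_n -> R) P x : Prop :=
  P x /\ forall y, P y -> f x <= f y.

(* Center of a largest closed ball contained in [P]; when [P] is nonempty,
   bounded and has empty interior, every point of [P] is one (radius 0). *)
Definition chebyshev_center P x : Prop :=
  exists2 r : R, 0 <= r /\ [set y | enorm (y - x) <= r] `<=` P &
    forall x' r', 0 <= r' -> [set y | enorm (y - x') <= r'] `<=` P -> r' <= r.

Definition feasible_dirs P x : set 'cV[R]_n :=
  [set d | exists2 th : R, 0 < th & P (x + th *: d)].

(* Meaningful when [feasible_dirs P x] is a convex cone, i.e., [P] convex. *)
Definition extreme_dir P x (g : 'cV[R]_n) : Prop :=
  [/\ g != 0, feasible_dirs P x g &
    forall d1 d2, feasible_dirs P x d1 -> feasible_dirs P x d2 ->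
      g = d1 + d2 -> exists2 a : R, 0 <= a & d1 = a *: g].

(* [g] lists every extreme direction of [P] at [x], once up to scaling; the
   cuts do not depend on the scaling. *)
Definition extreme_dirs P x (g : 'I_n -> 'cV[R]_n) : Prop :=
  [/\ forall i, extreme_dir P x (g i),
      forall i j (a : R), 0 < a -> g i = a *: g j -> i = j &
      forall d, extreme_dir P x d -> exists i, exists2 a : R, 0 < a & d = a *: g i].

(* The half-space [\sum_i xi_i / t_i >= 1] in the coordinates
   [x = v + \sum_i xi_i g_i]; in [\bar R], [+oo^-1 = 0]. *)
Definition cut_set v (g : 'I_n -> 'cV[R]_n) (t : 'I_n -> \bar R) : set 'cV[R]_n :=
  [set x | exists2 xi : 'I_n -> R,
     x = v + \sum_(i < n) xi i *: g i &
     (1 <= \sum_(i < n) (xi i)%:E / t i)%E].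

End Geometry.

Definition psdmx {R : realType} {k : nat} (M : 'M[R]_k) : Prop :=
  M^T = M /\ forall x : 'cV[R]_k, 0 <= (x^T *m M *m x) 0 0.

(* A node carries a description [lhs x <= rhs] of its polytope, since the
   semidefinite program and nondegeneracy refer to the description. *)
Record node (R : realType) (n : nat) := Node {
  nrows : nat;
  lhs : 'M[R]_(nrows, n);
  rhs : 'cV[R]_nrows }.
Arguments Node {R n nrows} lhs rhs.

HB.instance Definition _ (R : realType) (n : nat) := gen_eqMixin (node R n).

Definition poly_of {R : realType} {n : nat} (N : node R n) : set 'cV[R]_n :=
  [set x | forall i, (lhs N *m x) i 0 <= rhs N i 0].

Definition nondegenerate {R : realType} {n : nat} (N : node R n) (v : 'cV[R]_n) : Prop :=
  #|[set i | (lhs N *m v) i 0 == rhs N i 0]%SET| = n.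

(* A node together with its address in the binary search tree: the root has
   address [::], the two children of a node with address [a] have addresses
   [rcons a false] and [rcons a true]. *)
Definition anode (R : realType) (n : nat) := (seq bool * node R n)%type.

Definition child_of {R : realType} {n : nat} (M N : anode R n) : Prop :=
  exists e : bool, M.1 = rcons N.1 e.

Section Algorithm.
Context {R : realType} {n : nat}.
Variables (Q : 'M[R]_n) (c : 'cV[R]_n) (X : node R n) (eps : R).

Definition qfun (x : 'cV[R]_n) : R := dot x (Q *m x) + 2 * dot c x.

Definition Bfun (x y : 'cV[R]_n) : R := dot x (Q *m y) + dot c x + dot c y.

Definition sdp_mx (N : node R n) (l : R) (Y : 'M[R]_(nrows N)) (y : 'cV[R]_(nrows N))
    : 'M[R]_(n + 1) :=
  let A := lhs N in let b := rhs N in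
  block_mx (- (A^T *m Y *m A)) (A^T *m (Y *m b + 2^-1 *: y))
           ((Y *m b + 2^-1 *: y)^T *m A) (- (y^T *m b) - b^T *m Y *m b)
  + block_mx Q c c^T (- l)%:M.

Definition sdp_feasible (u : \bar R) (N : node R n) (l : R)
    (Y : 'M[R]_(nrows N)) (y : 'cV[R]_(nrows N)) : Prop :=
  [/\ psdmx (sdp_mx l Y y), (l%:E <= u)%E, forall i j, 0 <= Y i j,
      Y = Y^T & forall i, 0 <= y i 0].

Definition sdp_optimal (u : \bar R) (N : node R n) (l : R)
    (Y : 'M[R]_(nrows N)) (y : 'cV[R]_(nrows N)) : Prop :=
  sdp_feasible u l Y y /\
  forall l' Y' y', @sdp_feasible u N l' Y' y' -> l' <= l.

Definition relaxation (N : node R n) (Y : 'M[R]_(nrows N)) (y : 'cV[R]_(nrows N))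
    (x : 'cV[R]_n) : R :=
  let A := lhs N in let b := rhs N in
  dot x ((Q - A^T *m Y *m A) *m x)
  + 2 * dot (c + A^T *m Y *m b + 2^-1 *: (A^T *m y)) x.

(* [v] is a vertex that may be computed on [P] (with [P] either the whole
   feasible set or the node's polytope) from the optimal multipliers. *)
Definition upper_vertex (N : node R n) (Y : 'M[R]_(nrows N)) (y : 'cV[R]_(nrows N))
    (P : set 'cV[R]_n) (v : 'cV[R]_n) : Prop :=
  exists xh, [/\ minimizer (relaxation Y y) P xh, local_opt_vertex qfun P v &
                 qfun v <= qfun xh].

Definition update (u : \bar R) (v : 'cV[R]_n) : \bar R := Order.min u (qfun v)%:E.

(* The supremum in [\bar R] of a set of step lengths; these sets are closed,
   so it is their maximum, or [+oo] when they are unbounded. *)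
Definition max_step (S : set R) : \bar R := ereal_sup [set th%:E | th in S].

Definition tuy_step (u : \bar R) (v g : 'cV[R]_n) : \bar R :=
  max_step [set th : R | (u - eps%:E <= (qfun (v + th *: g))%:E)%E].

Definition tuy_set (u : \bar R) (P : set 'cV[R]_n) (v : 'cV[R]_n)
    (g : 'I_n -> 'cV[R]_n) : set 'cV[R]_n :=
  P `&` cut_set v g (fun i => tuy_step u v (g i)).

Definition konno_step (u : \bar R) (v g : 'cV[R]_n) (T : set 'cV[R]_n) : \bar R :=
  max_step [set th : R | forall y, T y -> (u - eps%:E <= (Bfun (v + th *: g) y)%:E)%E].

(* [y] minimizes [B (v + t g, _)] over [T]. For [t = +oo] this is read as:
   for all large finite steps. (In that case [q] is bounded below along the
   ray, so [Q g = 0] when [Q] is negative semidefinite, and the minimizers do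
   not depend on the step.) *)
Definition cut_minimizer (v g : 'cV[R]_n) (t : \bar R) (T : set 'cV[R]_n)
    (y : 'cV[R]_n) : Prop :=
  match t with
  | th%:E => minimizer (Bfun (v + th *: g)) T y
  | +oo%E => exists M : R, forall th, M <= th -> minimizer (Bfun (v + th *: g)) T y
  | -oo%E => False
  end.

(* Outcome [P'] of the cutting step at the vertex [v] of [N], with current
   upper bound [u]. When [T] is empty the minimum over it is [+oo] and the
   vertex is eligible. *)
Inductive cutting (u : \bar R) (N : node R n) (v : 'cV[R]_n) : set 'cV[R]_n -> Prop :=
| CutDegenerate :
    ~ nondegenerate N v -> cutting u N v (poly_of N)
| CutIneligible (g ys : 'I_n -> 'cV[R]_n) :
    nondegenerate N v -> extreme_dirs (poly_of N) v g ->
    (forall i, cut_minimizer v (g i) (tuy_step u v (g i))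
                 (tuy_set u (poly_of N) v g) (ys i)) ->
    (exists i, (qfun (ys i))%:E < u - eps%:E)%E ->
    cutting u N v (poly_of N)
| CutKonnoEmpty (g : 'I_n -> 'cV[R]_n) :
    nondegenerate N v -> extreme_dirs (poly_of N) v g ->
    tuy_set u (poly_of N) v g = set0 ->
    cutting u N v (poly_of N `&`
      cut_set v g (fun i => konno_step u v (g i) (tuy_set u (poly_of N) v g)))
| CutKonno (g ys : 'I_n -> 'cV[R]_n) :
    nondegenerate N v -> extreme_dirs (poly_of N) v g ->
    (forall i, cut_minimizer v (g i) (tuy_step u v (g i))
                 (tuy_set u (poly_of N) v g) (ys i)) ->
    (forall i, u - eps%:E <= (qfun (ys i))%:E)%E ->
    cutting u N v (poly_of N `&`
      cut_set v g (fun i => konno_step u v (g i) (tuy_set u (poly_of N) v g))).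

(* [process u N u' s]: processing the node [N] with upper bound [u] may end
   with upper bound [u'] and created nodes [s]. The created nodes are given by
   any inequality descriptions of the two polytopes, e.g., by appending rows. *)
Inductive process (u : \bar R) (N : anode R n) : \bar R -> seq (anode R n) -> Prop :=
| FathomBound l Y y v :
    @sdp_optimal u N.2 l Y y ->
    upper_vertex Y y (poly_of X) v ->
    (update u v <= l%:E + eps%:E)%E ->
    process u N (update u v) [::]
| FathomCut l Y y v w P :
    @sdp_optimal u N.2 l Y y ->
    upper_vertex Y y (poly_of X) v ->
    (l%:E + eps%:E < update u v)%E ->
    upper_vertex Y y (poly_of N.2) w ->
    cutting (update (update u v) w) N.2 w P ->
    P = set0 ->
    process u N (update (update u v) w) [::]
| Branch l Y y v w P d xc N1 N2 :
    @sdp_optimal u N.2 l Y y ->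
    upper_vertex Y y (poly_of X) v ->
    (l%:E + eps%:E < update u v)%E ->
    upper_vertex Y y (poly_of N.2) w ->
    cutting (update (update u v) w) N.2 w P ->
    P !=set0 ->
    d != 0 ->
    chebyshev_center P xc ->
    poly_of N1 = P `&` [set x | dot d x <= dot d xc] ->
    poly_of N2 = P `&` [set x | dot d xc <= dot d x] ->
    process u N (update (update u v) w)
      [:: (rcons N.1 false, N1); (rcons N.1 true, N2)].

Inductive process_seq : \bar R -> seq (anode R n) -> \bar R -> seq (anode R n) -> Prop :=
| ProcessNil u : process_seq u [::] u [::]
| ProcessCons u N s u1 s1 u2 s2 :
    process u N u1 s1 -> process_seq u1 s u2 s2 ->
    process_seq u (N :: s) u2 (s1 ++ s2).

(* One generation: its nodes are processed one after the other, in any order. *)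
Definition next_generation (u : \bar R) (G : seq (anode R n))
    (u' : \bar R) (G' : seq (anode R n)) : Prop :=
  exists2 s, perm_eq s G & process_seq u s u' G'.

(* [G k] is the [k]-th generation and [u k] the upper bound before it is
   processed. The algorithm stops at the first [k] with [G k = [::]]; all later
   generations are then empty too. *)
Definition execution (u : nat -> \bar R) (G : nat -> seq (anode R n)) : Prop :=
  [/\ u 0%N = +oo%E, G 0%N = [:: ([::], X)] &
      forall k, next_generation (u k) (G k) (u k.+1) (G k.+1)].

End Algorithm.

(* Along every infinite sequence of successively generated (hence nested)
   nodes, the diameters tend to zero. *)
Definition exhaustive {R : realType} {n : nat} (G : nat -> seq (anode R n)) : Prop :=
  forall N : nat -> anode R n,
    (forall k, N k \in G k) -> (forall k, child_of (N k.+1) (N k)) ->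
    diameter (poly_of (N k).2) @[k --> \oo] --> (0 : R).

(* Main.v *)
(** If the algorithm does not stop, Koenig's lemma gives an infinite path of nodes, each created
    from the previous one, whose diameters tend to zero. When a node of the path is processed, a
    vertex [w] of it is computed, so its child starts with an upper bound [u <= q w]. All points
    of the child are coordinatewise within a small [de] of [w]; by Farkas' lemma the box
    constraints around [w] are nonnegative combinations of the child's constraints, and their
    products yield multipliers showing that the child's semidefinite bound is at least
    [u - eps]. The child is therefore fathomed in the bounding step, a contradiction. *)
Require Import Defs.
From mathcomp Require Import all_boot all_order all_algebra.
From mathcomp Require Import all_classical all_reals all_analysis.
From mathcomp Require Import ring lra.

Set Implicit Arguments.
Unset Strict Implicit.
Unset Printing Implicit Defensive.

Import Order.TTheory GRing.Theory Num.Theory.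
Import numFieldNormedType.Exports.

Local Open Scope classical_set_scope.
Local Open Scope ring_scope.

(** * Dot products and quadratic forms *)

Section Dot.
Variables (R : realType) (n : nat).
Implicit Types (x y z : 'cV[R]_n) (a : R).

Lemma dotE x y : dot x y = \sum_i x i 0 * y i 0.
Proof. by rewrite /dot mxE; apply: eq_bigr => i _; rewrite mxE. Qed.

Lemma dotC x y : dot x y = dot y x.
Proof. by rewrite !dotE; apply: eq_bigr => i _; rewrite mulrC. Qed.

Lemma dotDr x y z : dot x (y + z) = dot x y + dot x z.
Proof. by rewrite /dot mulmxDr mxE. Qed.

Lemma dotDl x y z : dot (x + y) z = dot x z + dot y z.
Proof. by rewrite dotC dotDr !(dotC z). Qed.

Lemma dotNr x y : dot x (- y) = - dot x y.
Proof. by rewrite /dot mulmxN mxE. Qed.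

Lemma dotNl x y : dot (- x) y = - dot x y.
Proof. by rewrite dotC dotNr dotC. Qed.

Lemma dotZr a x y : dot x (a *: y) = a * dot x y.
Proof. by rewrite /dot -scalemxAr mxE. Qed.

Lemma dotZl a x y : dot (a *: x) y = a * dot x y.
Proof. by rewrite dotC dotZr dotC. Qed.

Lemma dot0l x : dot 0 x = 0.
Proof. by rewrite /dot trmx0 mul0mx mxE. Qed.

Lemma dot_suml (I : finType) (f : I -> 'cV[R]_n) x :
  dot (\sum_i f i) x = \sum_i dot (f i) x.
Proof.
by apply: (big_morph (dot^~ x)) => [y z|]; [exact: dotDl | exact: dot0l].
Qed.

Lemma dot_deltal j x : dot (delta_mx j 0) x = x j 0.
Proof.
rewrite dotE (bigD1 j) //= mxE !eqxx mul1r big1 ?addr0 // => i /negPf ij.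
by rewrite mxE ij mul0r.
Qed.

Lemma dotxx_ge0 x : 0 <= dot x x.
Proof. by rewrite dotE sumr_ge0 // => i _; rewrite -expr2 sqr_ge0. Qed.

Lemma sqr_coord_le_dotxx x j : x j 0 ^+ 2 <= dot x x.
Proof.
rewrite dotE (bigD1 j) //= -expr2 lerDl sumr_ge0 // => i _.
by rewrite -expr2 sqr_ge0.
Qed.

Lemma coord_le_enorm x j : `|x j 0| <= enorm x.
Proof. by rewrite /enorm -sqrtr_sqr ler_wsqrtr // sqr_coord_le_dotxx. Qed.

Lemma dot_mulmx_tr m (M : 'M[R]_(m, n)) (y : 'cV[R]_m) x :
  dot y (M *m x) = dot (M^T *m y) x.
Proof. by rewrite /dot trmx_mul trmxK mulmxA. Qed.

Lemma dot_mulmxE (M : 'M[R]_n) x y :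
  dot x (M *m y) = \sum_i \sum_j x i 0 * M i j * y j 0.
Proof.
rewrite dotE; apply: eq_bigr => i _; rewrite mxE mulr_sumr.
by apply: eq_bigr => j _; rewrite mulrA.
Qed.

(** Each term is controlled by [2 |x i x j| <= x i ^ 2 + x j ^ 2 <= 2 dot x x]. *)
Lemma quadratic_form_lower_bound (M : 'M[R]_n) x :
  - (\sum_i \sum_j `|M i j|) * dot x x <= dot x (M *m x).
Proof.
rewrite dot_mulmxE mulNr mulr_suml -sumrN ler_sum // => i _.
rewrite mulr_suml -sumrN ler_sum // => j _.
apply: lerNnormlW; rewrite mulrAC mulrC normrM ler_wpM2l //.
have h1 := sqr_coord_le_dotxx x i; have h2 := sqr_coord_le_dotxx x j.
rewrite ler_norml.
have := sqr_ge0 (x i 0 - x j 0); have := sqr_ge0 (x i 0 + x j 0).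
by move=> h3 h4; apply/andP; split; nra.
Qed.

End Dot.

(** * Farkas' lemma, homogeneous and affine *)

Lemma dot_col_mx (R : realType) (m n : nat) (a x : 'cV[R]_m) (b y : 'cV[R]_n) :
  dot (col_mx a b) (col_mx x y) = dot a x + dot b y.
Proof. by rewrite /dot tr_col_mx mul_row_col mxE. Qed.

(* Bartl's induction on the number of constraints. If the last constraint is not redundant, some
   [x0] violates it alone, and projecting along [x0] onto its kernel removes it. *)
Lemma farkas (R : realType) (n m : nat) (a : 'I_m -> 'cV[R]_n) (g : 'cV[R]_n) :
  (forall x, (forall i, dot (a i) x <= 0) -> dot g x <= 0) ->
  exists2 la : 'I_m -> R, forall i, 0 <= la i & g = \sum_i la i *: a i.
Proof.
elim: m a g => [|m IH] a g hg.
  exists (fun=> 0) => //; rewrite big_ord0.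
  have : dot g g <= 0 by apply: hg => -[].
  move=> gg; apply/matrixP => i j; rewrite ord1 mxE; apply/eqP.
  by rewrite -sqrf_eq0 eq_le sqr_ge0 (le_trans (sqr_coord_le_dotxx g i) gg).
have [h|] := pselect (forall x, (forall i, dot (a (lift ord0 i)) x <= 0) -> dot g x <= 0).
  have [la la0 ->] := IH _ _ h.
  exists (fun i => if unlift ord0 i is Some j then la j else 0).
    by move=> i; case: unliftP.
  rewrite big_ord_recl unlift_none scale0r add0r.
  by apply: eq_bigr => i _; rewrite liftK.
move=> /existsNP[x0 /not_implyP[hx0 /negP]]; rewrite -ltNge => gx0.
have p0 : 0 < dot (a ord0) x0.
  rewrite ltNge; apply/negP => h.
  suff : dot g x0 <= 0 by rewrite leNgt gx0.
  by apply: hg => i; case: (unliftP ord0 i) => [j ->|->].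
set p := dot (a ord0) x0 in p0.
pose a' i := a (lift ord0 i) - (dot (a (lift ord0 i)) x0 / p) *: a ord0.
pose g' := g - (dot g x0 / p) *: a ord0.
have [x hx|la la0 g'E] := IH a' g'.
  (* [y] is [x] slid along [x0] into the kernel of [a ord0]; by [yE], pairing a vector with [y] is
     pairing its reduction with [x]. *)
  pose y := x - (dot (a ord0) x / p) *: x0.
  have yE v : dot v y = dot (v - (dot v x0 / p) *: a ord0) x.
    rewrite dotDr dotDl dotNr dotNl dotZr dotZl; field.
    by rewrite gt_eqF.
  rewrite -yE; apply: hg => i; rewrite yE.
  case: (unliftP ord0 i) => [j ->|->]; first exact: hx.
  by rewrite divff ?gt_eqF // scale1r subrr dot0l.
(* The multiplier of [a ord0] collects what the reductions removed. It is nonnegative because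
   [dot g x0 > 0] while [x0] satisfies all the other constraints. *)
exists (fun i => if unlift ord0 i is Some j then la j
   else (dot g x0 - \sum_j la j * dot (a (lift ord0 j)) x0) / p).
  move=> i; case: unliftP => // _; rewrite divr_ge0 ?(ltW p0) // subr_ge0.
  rewrite (le_trans _ (ltW gx0)) // sumr_le0 // => j _.
  by rewrite mulr_ge0_le0.
rewrite big_ord_recl unlift_none.
have gE : g = g' + (dot g x0 / p) *: a ord0 by rewrite subrK.
rewrite [LHS]gE g'E [in LHS](eq_bigr (fun j => la j *: a (lift ord0 j)
    - ((la j * dot (a (lift ord0 j)) x0) / p) *: a ord0)); last first.
  by move=> j _; rewrite scalerBr scalerA mulrA.
rewrite sumrB -scaler_suml -mulr_suml mulrBl scalerBl.
rewrite [in RHS](eq_bigr (fun j => la j *: a (lift ord0 j))); last first.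
  by move=> j _; rewrite liftK.
by rewrite addrAC -addrA addrC.
Qed.

Definition slack (R : realType) (n : nat) (N : node R n) (x : 'cV[R]_n) (t : R) :
  'cV[R]_(nrows N) := t *: rhs N - lhs N *m x.

(* Farkas' lemma for the homogenized system; nonemptiness makes the recession directions [t = 0]
   of the node satisfy [dot a x <= 0]. *)
Lemma affine_farkas (R : realType) (n : nat) (N : node R n) (a : 'cV[R]_n) (be : R) :
    poly_of N !=set0 -> (forall x, poly_of N x -> dot a x <= be) ->
  exists (la : 'cV[R]_(nrows N)) (al : R), [/\ forall i, 0 <= la i 0, 0 <= al &
    forall x t, be * t - dot a x = dot la (slack N x t) + al * t].
Proof.
move=> [x0 Px0] valid.
(* Constraints on [(x, t)]: index [ord0] encodes [t >= 0], the others [lhs N x <= t rhs N]. *)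
pose r (i : 'I_(nrows N).+1) : 'cV[R]_(n + 1) :=
  if unlift ord0 i is Some j then col_mx (row j (lhs N))^T (- rhs N j 0)%:M
  else col_mx 0 (-1)%:M.
have rE j x t : dot (r (lift ord0 j)) (col_mx x t%:M) = (lhs N *m x) j 0 - rhs N j 0 * t.
  rewrite /r liftK dot_col_mx [dot (- _)%:M _]dotE big_ord1 !mxE eqxx !mulr1n mulNr.
  by rewrite [in LHS]dotE; congr (_ - _); apply: eq_bigr => i _; rewrite !mxE.
have r0E x t : dot (r ord0) (col_mx x t%:M) = - t.
  by rewrite /r unlift_none dot_col_mx dot0l add0r dotE big_ord1 !mxE eqxx !mulr1n mulN1r.
have gE x t : dot (col_mx a (- be)%:M) (col_mx x t%:M) = dot a x - be * t.
  by rewrite dot_col_mx [dot (- _)%:M _]dotE big_ord1 !mxE eqxx !mulr1n mulNr.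
have [|la la0 gla] := @farkas R _ _ r (col_mx a (- be)%:M).
  move=> z hz; move: hz; rewrite -(vsubmxK z) [dsubmx z]mx11_scalar.
  set x := usubmx z; set t := dsubmx z 0 0 => hz.
  have t0 : 0 <= t by have := hz ord0; rewrite r0E oppr_le0.
  have {}hz j : (lhs N *m x) j 0 <= rhs N j 0 * t.
    by have := hz (lift ord0 j); rewrite rE subr_le0.
  rewrite gE subr_le0; move: t0; rewrite le_eqVlt => /predU1P[t0|t0].
    rewrite -t0 mulr0 leNgt; apply/negP => ax.
    have {}hz j : (lhs N *m x) j 0 <= 0 by rewrite (le_trans (hz j)) // -t0 mulr0.
    (* With this step length the point [x0 + s *: x] of the node would have [dot a] equal to
       [be + 1]. *)
    pose s := (be - dot a x0 + 1) / dot a x.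
    have s0 : 0 <= s by rewrite divr_ge0 ?(ltW ax) // addr_ge0 // subr_ge0 valid.
    have : dot a (x0 + s *: x) <= be.
      apply: valid => j; rewrite mulmxDr -scalemxAr mxE [X in _ + X]mxE.
      by rewrite -[leRHS]addr0 lerD // ?Px0 // mulr_ge0_le0.
    rewrite dotDr dotZr divfK ?gt_eqF //; lra.
  rewrite -ler_pdivrMr // mulrC -dotZr; apply: valid => j.
  by rewrite -scalemxAr mxE mulrC ler_pdivrMr.
exists (\col_j la (lift ord0 j)), (la ord0); split => //.
  by move=> i; rewrite mxE.
move=> x t; rewrite -opprB -gE gla dot_suml big_ord_recl dotZl r0E mulrN opprD opprK.
rewrite addrC dotE -sumrN; congr (_ + _); apply: eq_bigr => j _.
rewrite dotZl rE /slack !mxE -mulrN opprB [t * _]mulrC.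
by congr (_ * (_ - _)); rewrite mxE.
Qed.

(** * Quadratic forms in the slacks *)

(* The quadratic forms the semidefinite program can subtract from [q], up to a nonnegative
   constant, on the cone over the node. *)
Definition slack_form (R : realType) (n : nat) (N : node R n) (f : 'cV[R]_n -> R -> R) :=
  exists (Y : 'M[R]_(nrows N)) (y : 'cV[R]_(nrows N)) (C : R),
    [/\ forall i j, 0 <= Y i j, Y = Y^T, forall i, 0 <= y i 0, 0 <= C &
        forall x t, f x t = dot (slack N x t) (Y *m slack N x t)
                            + t * dot y (slack N x t) + C * t ^+ 2].

Section SlackForm.
Variables (R : realType) (n : nat) (N : node R n).
Implicit Types (f g : 'cV[R]_n -> R -> R).

Lemma slack_form_sum (I : finType) (f : I -> 'cV[R]_n -> R -> R) :
  (forall i, slack_form N (f i)) -> slack_form N (fun x t => \sum_i f i x t).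
Proof.
move=> hf; have {hf} /choice[Y /choice[y /choice[C hf]]] := hf.
exists (\sum_i Y i), (\sum_i y i), (\sum_i C i); split => [i j||i||].
- by rewrite summxE sumr_ge0 // => k _; have [] := hf k.
- by rewrite raddf_sum; apply: eq_bigr => k _; have [] := hf k.
- by rewrite summxE sumr_ge0 // => k _; have [] := hf k.
- by apply: sumr_ge0 => k _; have [] := hf k.
- move=> x t; rewrite dot_suml mulmx_suml.
  rewrite dotC dot_suml mulr_sumr mulr_suml -!big_split; apply: eq_bigr => k _ /=.
  by have [_ _ _ _ ->] := hf k; rewrite [dot (Y k *m _) _]dotC.
Qed.

Lemma slack_form_scale (a : R) f :
  0 <= a -> slack_form N f -> slack_form N (fun x t => a * f x t).
Proof.
move=> a0 [Y [y [C [Y0 YT y0 C0 fE]]]].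
exists (a *: Y), (a *: y), (a * C); split.
- by move=> i j; rewrite mxE mulr_ge0.
- by rewrite linearZ /= -YT.
- by move=> i; rewrite mxE mulr_ge0.
- by rewrite mulr_ge0.
- by move=> x t; rewrite fE -scalemxAl dotZr dotZl; ring.
Qed.

(** By [affine_farkas] each factor is a nonnegative combination of the slacks and [t]. In the
    expanded product, [Y] is the symmetrization of a rank-one matrix of multipliers. *)
Lemma slack_form_mul (a b : 'cV[R]_n) (be ga : R) :
    poly_of N !=set0 -> (forall x, poly_of N x -> dot a x <= be) ->
    (forall x, poly_of N x -> dot b x <= ga) ->
  slack_form N (fun x t => (be * t - dot a x) * (ga * t - dot b x)).
Proof.
move=> N0 ha hb.
have [la [al [la0 al0 aE]]] := affine_farkas N0 ha.
have [mu [be' [mu0 be0 bE]]] := affine_farkas N0 hb.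
exists (2^-1 *: (la *m mu^T + mu *m la^T)), (al *: mu + be' *: la), (al * be'); split.
- move=> i j; rewrite !mxE mulr_ge0 ?invr_ge0 ?ler0n // addr_ge0 // sumr_ge0 // => k _;
    by rewrite !mxE ord1 mulr_ge0.
- by rewrite [RHS]linearZ /= [X in _ = _ *: X]linearD /= !trmx_mul !trmxK addrC.
- by move=> i; rewrite !mxE addr_ge0 // mulr_ge0.
- exact: mulr_ge0.
- move=> x t; rewrite aE bE; move: (slack N x t) => s.
  have E u v : dot s (u *m v^T *m s) = dot u s * dot v s.
    rewrite -mulmxA [v^T *m s]mx11_scalar mul_mx_scalar dotZr.
    by rewrite mulrC (dotC s).
  rewrite -scalemxAl dotZr mulmxDl [dot s (_ + _)]dotDr !E dotDl !dotZl; by field.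
Qed.

End SlackForm.

(** * The semidefinite program in homogeneous coordinates *)

Lemma dot_block_mx (R : realType) (n : nat) (A : 'M[R]_n) (B : 'cV[R]_n)
    (C : 'rV[R]_n) (D : 'M[R]_1) (x : 'cV[R]_n) (t : R) :
  dot (col_mx x t%:M) (block_mx A B C D *m col_mx x t%:M) =
  dot x (A *m x) + t * (dot B x + dot C^T x) + D 0 0 * t ^+ 2.
Proof.
have e (M : 'cV[R]_1) : dot t%:M M = t * M 0 0.
  by rewrite dotE big_ord1 !mxE eqxx mulr1n.
rewrite mul_block_col dot_col_mx !mul_mx_scalar !dotDr !dotZr !e (dotC B).
rewrite [dot C^T x]/dot trmxK; ring.
Qed.

Section SdpForm.
Variables (R : realType) (n : nat) (Q : 'M[R]_n) (c : 'cV[R]_n) (N : node R n).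
Variables (l : R) (Y : 'M[R]_(nrows N)) (y : 'cV[R]_(nrows N)).
Hypotheses (QT : Q^T = Q) (YT : Y = Y^T).

Lemma sdp_mx_sym : (sdp_mx Q c l Y y)^T = sdp_mx Q c l Y y.
Proof.
rewrite /sdp_mx [LHS]linearD /= !tr_block_mx QT tr_scalar_mx !trmxK.
congr (block_mx _ _ _ _ + _).
- by rewrite [LHS]linearN /= !trmx_mul trmxK -YT mulmxA.
- by rewrite trmx_mul trmxK.
- by rewrite trmx_mul trmxK.
- by apply/matrixP => i j; rewrite !ord1 mxE.
Qed.

(** The blocks of [sdp_mx] built from [lhs N] and [rhs N] are minus the coefficients of the slack
    form of [Y] and [y], so semidefiniteness compares this form with the homogenized [q - l]. *)
Lemma sdp_mx_form (x : 'cV[R]_n) (t : R) :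
  ((col_mx x t%:M)^T *m sdp_mx Q c l Y y *m col_mx x t%:M) 0 0 =
  dot x (Q *m x) + 2 * t * dot c x - l * t ^+ 2
  - (dot (slack N x t) (Y *m slack N x t) + t * dot y (slack N x t)).
Proof.
have YC u v : dot u (Y *m v) = dot v (Y *m u) by rewrite dot_mulmx_tr -YT dotC.
rewrite -mulmxA -[_ 0 0]/(dot _ _) /sdp_mx add_block_mx dot_block_mx.
rewrite mulmxDl dotDr mulNmx dotNr -!mulmxA.
rewrite [(_ + c^T)^T]linearD /= trmx_mul !trmxK.
set D := (_ + (- l)%:M) 0 0.
have -> : D = - dot y (rhs N) - dot (rhs N) (Y *m rhs N) - l.
  by rewrite /D /dot !mxE eqxx mulr1n.
rewrite !dotDl [dot x (_^T *m _)]dotC -!dot_mulmx_tr /slack.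
move: (lhs N *m x) (rhs N) => p b.
rewrite mulmxBr -scalemxAr !(dotDl, dotDr, dotNl, dotNr, dotZl, dotZr).
rewrite (YC b p) (dotC (Y *m b)) (dotC (Y *m p)).
by field.
Qed.

End SdpForm.

(* Around a centre [w] with [q w >= u], every coordinate contributes the product of slacks
   [(w j + de - x j) * (x j - w j + de) = de ^+ 2 - (x j - w j) ^+ 2]; subtracting [M] times their
   sum makes [q] convex with minimum at least [u - eps] for a suitable choice of [M] and [de]. *)
Lemma sdp_feasible_near (R : realType) (n : nat) (Q : 'M[R]_n) (c w : 'cV[R]_n)
    (N : node R n) (u eps de L M : R) :
    Q^T = Q -> 0 < eps -> 0 < L -> \sum_i \sum_j `|Q i j| + L <= M ->
    M * n%:R * de ^+ 2 <= eps / 2 ->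
    dot (Q *m w + c) (Q *m w + c) <= L * (eps / 2) ->
    u <= qfun Q c w ->
    poly_of N !=set0 -> (forall x, poly_of N x -> forall j, `|x j 0 - w j 0| <= de) ->
  exists Y y, @sdp_feasible R n Q c u%:E N (u - eps) Y y.
Proof.
move=> QT eps0 L0 LM hde hg uw N0 near_w.
have M0 : 0 <= M.
  by rewrite (le_trans _ LM) // addr_ge0 ?(ltW L0) //; apply: sumr_ge0 => i _; apply: sumr_ge0.
have slacks j : slack_form N (fun x t => ((w j 0 + de) * t - dot (delta_mx j 0) x) *
                                        ((de - w j 0) * t - dot (- delta_mx j 0) x)).
  by apply: slack_form_mul => // x /near_w /(_ j); rewrite ?dotNl dot_deltal ler_norml;
    case/andP; lra.
have [Y [y [C [Y0 YT y0 C0 fE]]]] := slack_form_scale M0 (slack_form_sum slacks).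
exists Y, y; split => //; last by rewrite lee_fin lerBlDr lerDl ltW.
split; first exact: sdp_mx_sym.
move=> z; rewrite -(vsubmxK z) [dsubmx z]mx11_scalar.
set x := usubmx z; set t := dsubmx z 0 0.
rewrite sdp_mx_form //.
(* Trades the form in [Y] and [y] for [M] times the sum of products, minus [C * t ^+ 2]. *)
have /esym/(canRL (addrK _)) -> := fE x t.
pose v := x - t *: w.
have -> : \sum_j ((w j 0 + de) * t - dot (delta_mx j 0) x) *
                 ((de - w j 0) * t - dot (- delta_mx j 0) x)
          = n%:R * de ^+ 2 * t ^+ 2 - dot v v.
  have -> : n%:R * de ^+ 2 * t ^+ 2 = \sum_(j < n) de ^+ 2 * t ^+ 2.
    by rewrite sumr_const card_ord -mulrA mulr_natl.
  rewrite dotE -sumrB.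
  by apply: eq_bigr => j _; rewrite !dotNl !dot_deltal !mxE; ring.
(* Taylor expansion of the homogenized [q] about [t *: w]; half the gradient of [q] at [w] is
   [Q *m w + c]. *)
have -> : dot x (Q *m x) + 2 * t * dot c x =
          t ^+ 2 * qfun Q c w + 2 * t * dot (Q *m w + c) v + dot v (Q *m v).
  have -> : x = v + t *: w by rewrite subrK.
  move: v => {}v.
  have QC : dot w (Q *m v) = dot v (Q *m w) by rewrite dot_mulmx_tr QT dotC.
  rewrite /qfun mulmxDr -scalemxAr !(dotDl, dotDr, dotZl, dotZr) QC (dotC (Q *m w)).
  ring.
move: (Q *m w + c) hg v => g hg v.
have h1 := quadratic_form_lower_bound Q v.
(* Completing the square: [L] times this is the squared norm of [L *: v + t *: g] plus
   [t ^+ 2 * (L * (eps / 2) - dot g g)]. It spends one half of [eps]; [hde] spends the other. *)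
have h2 : 0 <= L * dot v v + 2 * t * dot g v + t ^+ 2 * (eps / 2).
  rewrite -(pmulr_rge0 _ L0).
  have := dotxx_ge0 (L *: v + t *: g).
  rewrite !(dotDl, dotDr, dotZl, dotZr) (dotC v g) => h.
  have := ler_wpM2l (sqr_ge0 t) hg; nra.
have h3 : (\sum_i \sum_j `|Q i j| + L) * dot v v <= M * dot v v by rewrite ler_wpM2r ?dotxx_ge0.
have h4 := ler_wpM2r (sqr_ge0 t) hde.
have h5 : u * t ^+ 2 <= qfun Q c w * t ^+ 2 by rewrite ler_wpM2r ?sqr_ge0.
have h6 : 0 <= C * t ^+ 2 by rewrite mulr_ge0 ?sqr_ge0.
lra.
Qed.

(** * Bounded sets and diameters *)

Section Bounded.
Variables (R : realType) (n : nat) (P : set 'cV[R]_n).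
Hypothesis P_bounded : bounded_set P.

Lemma bounded_coord : exists2 B, 0 <= B & forall x, P x -> forall j, `|x j 0| <= B.
Proof.
have [B [_ hB]] := P_bounded.
exists (`|B| + 1) => [|x Px j]; first by rewrite addr_ge0.
have : `|x| <= `|B| + 1 by apply: hB => //; rewrite ltr_pwDr // ler_norm.
by apply: le_trans; rewrite /Num.norm /= mx_normrE; exact: (le_bigmax _ _ (j, 0)).
Qed.

(** Serves twice: with [Q] and [c] it bounds the gradient of [q] uniformly, with the identity matrix
    it bounds Euclidean norms. *)
Lemma bounded_affine_image (m : nat) (A : 'M[R]_(m, n)) (b : 'cV[R]_m) :
  exists2 C, 0 < C & forall x, P x -> dot (A *m x + b) (A *m x + b) <= C.
Proof.
have [B B0 hB] := bounded_coord.
exists (\sum_i (\sum_j `|A i j| * B + `|b i 0|) ^+ 2 + 1) => [|x Px].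
  by rewrite ltr_wpDl // sumr_ge0 // => i _; rewrite sqr_ge0.
rewrite dotE -[leLHS]addr0 lerD // ler_sum // => i _.
rewrite -expr2 -real_normK ?num_real // lerXn2r ?nnegrE //.
  by rewrite addr_ge0 // sumr_ge0 // => j _; rewrite mulr_ge0.
rewrite !mxE (le_trans (ler_normD _ _)) // lerD // (le_trans (ler_norm_sum _ _ _)) //.
by apply: ler_sum => j _; rewrite normrM ler_wpM2l // hB.
Qed.

(** The [sup] bounds its set only if some bound exists; the parallelogram law supplies one from a
    bound [C] on squared norms. *)
Lemma enorm_le_diameter (x y : 'cV[R]_n) : P x -> P y -> enorm (x - y) <= diameter P.
Proof.
move=> Px Py; apply: ub_le_sup; last by exists x, y.
have [C C0 hC] := bounded_affine_image 1%:M 0.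
exists (Num.sqrt (4 * C)) => _ [a [b [Pa Pb ->]]].
rewrite ler_wsqrtr //.
have := hC a Pa; have := hC b Pb; rewrite !mul1mx !addr0.
have := dotxx_ge0 (a + b).
rewrite !(dotDl, dotDr, dotNl, dotNr) (dotC b a); lra.
Qed.

End Bounded.

(* Koenig's lemma, with nodes that may occur in several generations. *)
Section Koenig.
Variables (T : eqType) (G : nat -> seq T) (E : nat -> T -> T -> Prop).

Fixpoint descendant (j k : nat) (x y : T) : Prop :=
  if j is j'.+1 then exists z, [/\ z \in G k.+1, E k x z & descendant j' k.+1 z y]
  else x = y.

Lemma descendant_rcons j k x y z : descendant j k x y -> z \in G (k + j).+1 ->
  E (k + j) y z -> descendant j.+1 k x z.
Proof.
elim: j k x => [|j IH] k x /=.
  by rewrite addn0 => -> zG yz; exists z.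
move=> [x' [x'G xx' x'y]]; rewrite addnS -addSn => zG yz.
by exists x'; split => //; apply: IH.
Qed.

Lemma descendantS j k x y : descendant j.+1 k x y -> exists z, descendant j k x z.
Proof.
elim: j k x => [|j IH] k x; first by exists x.
by move=> [x' [x'G xx' /IH[z x'z]]]; exists z, x'.
Qed.

Lemma descendant_le i j k x y : (i <= j)%N ->
  descendant j k x y -> exists z, descendant i k x z.
Proof.
move=> ij; rewrite -(subnK ij) addnC; elim: (j - i)%N y => [|m IH] y.
  by rewrite addn0; exists y.
by rewrite addnS => /descendantS[z /IH].
Qed.

Lemma koenig :
  (forall k, G k <> [::]) ->
  (forall k y, y \in G k.+1 -> exists2 x, x \in G k & E k x y) ->
  exists N : nat -> T, forall k, N k \in G k /\ E k (N k) (N k.+1).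
Proof.
move=> G_neq0 parent.
(* Alive elements have descendants at every depth; the path is built by always moving to an alive
   child. *)
pose alive k x := forall j, exists y, descendant j k x y.
(* If no relevant element of a finite list is alive, the maximum of their individual depths is one
   that none of them reaches. *)
have bounded k (A : T -> Prop) (s : seq T) : (forall y, y \in s -> A y -> ~ alive k y) ->
    exists J, forall y, y \in s -> A y -> ~ exists z, descendant J k y z.
  elim: s => [|a s IH] h; first by exists 0%N.
  have [|J hJ] := IH; first by move=> y ys; apply: h; rewrite in_cons ys orbT.
  have [Aa|nAa] := pselect (A a); last first.
    by exists J => y; rewrite in_cons => /predU1P[->//|]; exact: hJ.
  have /existsNP[Ja hJa] := h a (mem_head _ _) Aa.
  exists (maxn J Ja) => y; rewrite in_cons => /predU1P[-> _|ys Ay] [z].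
    by move/(descendant_le (leq_maxr J Ja)).
  by move/(descendant_le (leq_maxl J Ja)); apply: hJ.
have step k x : alive k x -> exists y, [/\ y \in G k.+1, E k x y & alive k.+1 y].
  move=> xalive; apply: contrapT => no.
  have [|J hJ] := bounded k.+1 (E k x) (G k.+1).
    by move=> y yG xy yalive; apply: no; exists y.
  have [z [y [yG xy yz]]] := xalive J.+1.
  by apply: (hJ y yG xy); exists z.
(* Tracing back to generation [0] turns nonempty generations into descendants of arbitrary depth, so
   some root is alive. *)
have root j : forall y, y \in G j -> exists2 x, x \in G 0%N & descendant j 0 x y.
  elim: j => [|j IH] y yG; first by exists y.
  have [y' /IH[x xG xy'] y'y] := parent _ _ yG.
  by exists x => //; apply: descendant_rcons xy' _ _; rewrite add0n.
have [r rG ralive] : exists2 r, r \in G 0%N & alive 0%N r.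
  apply: contrapT => no.
  have [|J hJ] := bounded 0%N (fun=> True) (G 0%N).
    by move=> y yG _ yalive; apply: no; exists y.
  case GJ : (G J) (G_neq0 J) => [//|y s] _.
  have [|x xG xy] := root J y; first by rewrite GJ mem_head.
  by apply: (hJ x xG I); exists y.
have /choice[next nextP] : forall p : nat * T, exists y, alive p.1 p.2 ->
    [/\ y \in G p.1.+1, E p.1 p.2 y & alive p.1.+1 y].
  move=> [k x]; have [/step[y xy]|nx] := pselect (alive k x); first by exists y.
  by exists x.
pose fix N k := if k is k'.+1 then next (k', N k') else r.
have Nalive k : N k \in G k /\ alive k (N k).
  by elim: k => [//|k [_ /(nextP (k, _))[]]].
by exists N => k; have [NG /(nextP (k, _))[]] := Nalive k.
Qed.

End Koenig.

(** * Runs of the algorithm *)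

Section Runs.
Variables (R : realType) (n : nat) (Q : 'M[R]_n) (c : 'cV[R]_n) (X : node R n) (eps : R).

Lemma update_le (u : \bar R) v : (update Q c u v <= u)%E.
Proof. by rewrite /update ge_min lexx. Qed.

Lemma update_le_qfun (u : \bar R) v : (update Q c u v <= (qfun Q c v)%:E)%E.
Proof. by rewrite /update ge_min lexx orbT. Qed.

Lemma process_le u N u' s : process Q c X eps u N u' s -> (u' <= u)%E.
Proof.
by case=> *; do ?[exact: update_le | apply: (le_trans (update_le _ _))].
Qed.

Lemma process_seq_le u s u' s' : process_seq Q c X eps u s u' s' -> (u' <= u)%E.
Proof.
by elim=> [//|{}u N {}s u1 s1 u2 s2 /process_le u1u _ u2u1]; apply: le_trans u1u.
Qed.

(* [M] is created from [N] in a generation that starts with upper bound [u] and ends with [u']. *)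
Definition created (u u' : \bar R) (N M : anode R n) : Prop :=
  exists u1 u2 s, [/\ (u1 <= u)%E, (u' <= u2)%E, process Q c X eps u1 N u2 s & M \in s].

(** Bounds only decrease, so a node processed within the generation starts with at most [u] and ends
    with at least [u']. *)
Lemma process_seq_created u s u' s' M :
  process_seq Q c X eps u s u' s' -> M \in s' -> exists2 N, N \in s & created u u' N M.
Proof.
elim=> [//|{}u N {}s u1 s1 u2 s2 uNu1 ss2 IH].
rewrite mem_cat => /orP[Ms1|/IH[N' N's [v1 [v2 [r [v1u1 u2v2 pr Mr]]]]]].
  exists N; rewrite ?mem_head //; exists u, u1, s1; split => //.
  exact: process_seq_le ss2.
exists N'; first by rewrite in_cons N's orbT.
by exists v1, v2, r; split => //; apply: le_trans v1u1 (process_le uNu1).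
Qed.

Lemma cutting_sub u N v P : cutting Q c eps u N v P -> P `<=` poly_of N.
Proof. by case=> * x; first [done | case]. Qed.

Lemma vertex_mem (P : set 'cV[R]_n) v : is_vertex P v -> P v.
Proof.
by move=> [a [be [_ Pv]]]; have [] : (P `&` [set x | dot a x = be]) v by rewrite -Pv.
Qed.

Lemma chebyshev_center_mem (P : set 'cV[R]_n) x : chebyshev_center P x -> P x.
Proof.
move=> [r [r0 rP] _]; apply: rP => /=.
by rewrite subrr /enorm dot0l sqrtr0.
Qed.

Lemma created_child u u' N M : created u u' N M -> child_of M N.
Proof.
move=> [u1 [u2 [s [_ _ pr]]]]; case: pr => // l Y y v w P d xc N1 N2 _ _ _ _ _ _ _ _ _ _.
by rewrite !inE => /orP[]/eqP ->; [exists false|exists true].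
Qed.

(** The Chebyshev center lies in both halves, which gives the nonemptiness that [affine_farkas] asks
    for. *)
Lemma created_sub u u' N M : created u u' N M ->
  poly_of M.2 `<=` poly_of N.2 /\ poly_of M.2 !=set0.
Proof.
move=> [u1 [u2 [s [_ _ pr]]]].
case: pr => // l Y y v w P d xc N1 N2 _ _ _ _ /cutting_sub PN _ _ /chebyshev_center_mem Pxc.
move=> E1 E2; rewrite !inE => /orP[]/eqP -> /=; rewrite ?E1 ?E2.
  by split; [move=> x [/PN] | exists xc; split => /=].
by split; [move=> x [/PN] | exists xc; split => /=].
Qed.

(** Branching happens only after a vertex of the node itself has updated the bound; that vertex is
    [w]. *)
Lemma created_bound u u' N M : created u u' N M ->
  exists2 w, poly_of N.2 w & (u' <= (qfun Q c w)%:E)%E.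
Proof.
move=> [u1 [u2 [s [_ u'u2 pr]]]].
case: pr u'u2 => // l Y y v w P d xc N1 N2 _ _ _ [_ [_ [/vertex_mem Nw _] _]].
by move=> _ _ _ _ _ _ u'u2 _; exists w => //; apply: (le_trans u'u2 (update_le_qfun _ _)).
Qed.

(* A node that is not fathomed in the bounding step has no feasible point of the semidefinite
   program within [eps] of the current upper bound. *)
Lemma created_sdp_gap u u' N M : created u u' N M ->
  exists2 u1, (u1 <= u)%E & u1 <> -oo%E /\
    forall l Y y, @sdp_feasible R n Q c u1 N.2 l Y y -> (l%:E + eps%:E < u1)%E.
Proof.
move=> [u1 [u2 [s [u1u _ pr]]]].
case: pr u1u => // l Y y v w P d xc N1 N2 [_ lmax] _ gap _ _ _ _ _ _ _ u1u _.
have {}gap := lt_le_trans gap (update_le _ _).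
exists u1 => //; split => [u1oo|l' Y' y' /lmax l'l]; first by rewrite u1oo in gap.
by apply: le_lt_trans gap; rewrite leeD2r // lee_fin.
Qed.

End Runs.

(** * Finite convergence *)

Theorem theorem5 (R : realType) (n m : nat) (Q : 'M[R]_n) (c : 'cV[R]_n)
    (A : 'M[R]_(m, n)) (b : 'cV[R]_m) (eps : R)
    (Q_nsd : psdmx (- Q))
    (X_bounded : bounded_set (poly_of (Node A b)))
    (X_interior : (poly_of (Node A b))° !=set0)
    (eps_gt0 : 0 < eps)
    (u : nat -> \bar R) (G : nat -> seq (anode R n))
    (run : execution Q c (Node A b) eps u G)
    (G_exhaustive : exhaustive G) :
  exists K : nat, G K = [::].
Proof.
apply: contrapT => /forallNP never; have [_ G0 next] := run.
have QT : Q^T = Q by case: Q_nsd => + _; rewrite raddfN => /oppr_inj.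
have [|N NP] := koenig (E := fun k => created Q c (Node A b) eps (u k) (u k.+1)) never.
  move=> k y yG; have [s sG /process_seq_created/(_ yG)[x xs xy]] := next k.
  by exists x; rewrite -?(perm_mem sG).
have NG k := (NP k).1; have Nc k := (NP k).2.
have NX k : poly_of (N k).2 `<=` poly_of (Node A b).
  elim: k => [|k IH]; first by have := NG 0%N; rewrite G0 inE => /eqP ->.
  exact: subset_trans (created_sub (Nc k)).1 IH.
have diam0 := G_exhaustive N NG (fun k => created_child (Nc k)).
have [C C0 hC] := bounded_affine_image X_bounded Q c.
(* [L] makes [L * (eps / 2)] equal to [C], the bound on the squared norm of [Q *m w + c] over the
   feasible set. *)
pose L := 2 * C / eps; pose M := \sum_i \sum_j `|Q i j| + L.
have L0 : 0 < L by rewrite divr_gt0 // mulr_gt0.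
have M0 : 0 <= M by rewrite addr_ge0 ?(ltW L0) //; apply: sumr_ge0 => i _; apply: sumr_ge0.
pose D := M * n%:R + 1.
have D0 : 0 < D by rewrite ltr_wpDl // mulr_ge0.
(* As [de <= 1] gives [de ^+ 2 <= de], it suffices that [de * D <= eps / 2]; the [1] in [D] keeps
   the divisor positive. *)
pose de := Num.min 1 (eps / 2 / D).
have de0 : 0 < de by rewrite lt_min ltr01 !divr_gt0.
have deE : M * n%:R * de ^+ 2 <= eps / 2.
  have d1 : de <= 1 by rewrite ge_min lexx.
  have : de * D <= eps / 2 by rewrite -ler_pdivlMr // ge_min lexx orbT.
  have d2 : de ^+ 2 <= de by rewrite expr2 ger_pMl.
  have h := ler_wpM2l (mulr_ge0 M0 (ler0n _ n)) d2.
  rewrite /D; lra.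
have [k kde] : exists k, diameter (poly_of (N k).2) <= de.
  move/cvgrPdist_le/(_ _ de0) : diam0 => [k _ /(_ k (leqnn k))].
  rewrite sub0r normrN => /(le_trans (ler_norm _)) ?; by exists k.
have [w Nw uw] := created_bound (Nc k).
have [u1 u1u [u1oo gap]] := created_sdp_gap (Nc k.+1).
have u1w : (u1 <= (qfun Q c w)%:E)%E := le_trans u1u uw.
(* The bound with which [N k.+1] is processed is finite: it is at most [q w], where [w] was found
   one generation earlier, and it is not [-oo]. *)
case: u1 u1oo u1w gap {u1u} => [r _|//|//]; rewrite lee_fin => rw gap.
have [sub _] := created_sub (Nc k); have [sub' N0] := created_sub (Nc k.+1).
have [|||Y [y /gap]] := @sdp_feasible_near _ _ Q c w (N k.+1).2 r eps de L M QT eps_gt0 L0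
  (lexx _) deE _ rw.
- rewrite (_ : L * (eps / 2) = C); first exact: hC (NX k w Nw).
  by rewrite /L; field; rewrite gt_eqF.
- by have [x /sub' Nx] := N0; exists x.
- move=> x /sub Nx j; rewrite (_ : _ - _ = (x - w) j 0); last by rewrite !mxE.
  apply: le_trans (coord_le_enorm _ _) (le_trans _ kde).
  apply: enorm_le_diameter => //.
  have [B [B_real hB]] := X_bounded.
  by exists B; split => // B' /hB {}hB z /NX/hB.
- by rewrite -EFinD subrK ltxx.
Qed.
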